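(* Let $p$ be a prime and let $d \ge 0$ be an integer. Let $X = \mathrm{Cay}(\mathbb{F}_p^d, C)$ be a Cayley graph on the additive group $(\mathbb{F}_p^d, +)$. If either $\deg(X) < \kappa(p)$ or $\deg(X) \ge p^d - \kappa(p)$, then there is an $\mathbb{F}_p$-vector subspace $V \subseteq \mathbb{F}_p^d$ such that the induced subgraph $X|_V$ is a complete graph and is a core of $X$.
   Context: The function $\kappa$ on primes is defined by $\kappa(2) = 5$, $\kappa(3) = 12$, and $\kappa(p) = 2$ for every prime $p \ge 5$. For an abelian group $A$ (written additively), a connection set is a subset $C \subseteq A \setminus \{0\}$ with $-C = C$. The Cayley graph $\mathrm{Cay}(A, C)$ has vertex set $A$, and $x, y \in A$ are adjacent if and only if $x - y \in C$ (so it is undirected and loopless). $\deg(X)$ is the common degree of all vertices of $X$, i.e. $\deg(\mathrm{Cay}(A,C)) = |C|$. For a graph $X$ and $V \subseteq V(X)$, $X|_V$ is the subgraph of $X$ induced by $V$. A graph homomorphism is a map of vertices sending adjacent vertices to adjacent vertices; an endomorphism of a graph is a homomorphism from it to itself. A graph is a core if all its endomorphisms are invertible. A core of a graph $X$ is a subgraph of $X$ that is both a retract of $X$ (i.e. there is a homomorphism from $X$ to the subgraph restricting to the identity on the subgraph) and a core. *)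

(* Defs.v *)
From mathcomp Require Import all_boot all_order all_algebra.

Set Implicit Arguments.
Unset Strict Implicit.
Unset Printing Implicit Defensive.

Import GRing.Theory.

Local Open Scope ring_scope.

Record sgraph := SGraph {
  vertex :> finType;
  adj : rel vertex;
  adj_sym : symmetric adj;
  adj_irr : irreflexive adj
}.

Definition homomorphism (X Y : sgraph) (f : X -> Y) : Prop :=
  forall x y : X, adj x y -> adj (f x) (f y).

Definition is_core (X : sgraph) : Prop :=
  forall f : X -> X, homomorphism f ->
  exists g : X -> X, [/\ homomorphism g, cancel f g & cancel g f].

Definition complete (X : sgraph) : Prop :=
  forall x y : X, x != y -> adj x y.

Definition regular (X : sgraph) (k : nat) : Prop :=
  forall x : X, #|[set y | adj x y]| = k.

(* Only the restriction of sub_adj to sub_vert is relevant. *)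
Record subgraph (X : sgraph) := Subgraph {
  sub_vert : {set X};
  sub_adj : rel X;
  sub_adj_sym : symmetric sub_adj;
  sub_adjP : {in sub_vert &, forall x y, sub_adj x y -> adj x y}
}.

Section Subgraph.
Variables (X : sgraph) (Y : subgraph X).

Let sub_type : finType := {x : X | x \in sub_vert Y}.
Let sub_rel : rel sub_type := fun x y => sub_adj Y (val x) (val y).

Lemma sub_rel_sym : symmetric sub_rel.
Proof. by move=> x y; apply: sub_adj_sym. Qed.

Lemma sub_rel_irr : irreflexive sub_rel.
Proof.
move=> x; apply/negP => /(sub_adjP (valP x) (valP x)).
by rewrite adj_irr.
Qed.

Definition sgraph_of_subgraph : sgraph := SGraph sub_rel_sym sub_rel_irr.

End Subgraph.

Coercion sgraph_of_subgraph : subgraph >-> sgraph.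

Definition is_retract (X : sgraph) (Y : subgraph X) : Prop :=
  exists2 r : X -> Y, homomorphism r & forall y : Y, r (val y) = y.

Definition is_core_of (X : sgraph) (Y : subgraph X) : Prop :=
  is_retract Y /\ is_core Y.

Definition induced (X : sgraph) (V : {set X}) : subgraph X :=
  @Subgraph X V (@adj X) (@adj_sym X) (fun _ _ _ _ => id).

Record connection_set (A : finZmodType) := ConnectionSet {
  conn_set :> {set A};
  conn0 : 0 \notin conn_set;
  connN : [set - x | x in conn_set] = conn_set
}.

Section Cayley.
Variables (A : finZmodType) (C : connection_set A).

Definition cayley_adj : rel A := fun x y => x - y \in C.

Lemma conn_oppr (x : A) : (- x \in C) = (x \in C).
Proof. by rewrite -{1}(connN C) mem_imset //; apply: oppr_inj. Qed.

Lemma cayley_adj_sym : symmetric cayley_adj.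
Proof. by move=> x y; rewrite /cayley_adj -conn_oppr opprB. Qed.

Lemma cayley_adj_irr : irreflexive cayley_adj.
Proof. by move=> x; rewrite /cayley_adj subrr (negbTE (conn0 C)). Qed.

Definition Cay : sgraph := SGraph cayley_adj_sym cayley_adj_irr.

Lemma Cay_regular : regular Cay #|C|.
Proof.
move=> x; rewrite -(card_imset C (subrI x)).
apply: eq_card => y; rewrite inE; apply/idP/imsetP => [xyC | [c cC ->]].
  by exists (x - y); rewrite // subKr.
by rewrite /= /cayley_adj subKr.
Qed.

End Cayley.

(* Relevant only at primes. *)
Definition kappa (p : nat) : nat :=
  if p == 2 then 5 else if p == 3 then 12 else 2.

(* Main.v *)
Require Import Defs.
From HB Require Import structures.
From mathcomp Require Import all_boot all_order all_algebra.
From mathcomp Require Import finfield.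
From mathcomp Require Import zify ring.

Set Implicit Arguments.
Unset Strict Implicit.
Unset Printing Implicit Defensive.

Import GRing.Theory.
Local Open Scope ring_scope.

(** Everything reduces to linear algebra. If the space is V + W, where V \ {0}
    lies in the connection set C and W misses C, then V induces a complete
    graph, and the linear projection on V along W is a retraction: vectors
    with the same projection differ by an element of W, hence are not adjacent
    ([splits_core]). This condition on (C, V, W) becomes the same condition on
    (D, W, V) when C is replaced with D, the complement of C deprived of 0
    ([splits_complement]); so graphs of low and of high degree are handled by
    one statement: a symmetric set S of fewer than kappa(p) nonzero vectors
    admits such a pair of subspaces ([symmetric_splits]). For p >= 5 the set S
    is empty. For p = 2, 3 it is stable under nonzero scalars (a cone), and
    kappa(p) = q^2 + 2 q - 3 where q = p is the order of the field.

    So let S be such a cone, and let W be a subspace missing S, of maximal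
    dimension. By maximality, S meets every coset of W other than W itself
    ([maximal_missing_meets_cosets]). Hence q^m - 1 <= |S|, where m is the
    codimension of W, and so m <= 2. If m = 0, V = 0 is suitable, and if
    m = 1, V can be any line spanned by an element of S. There remains the
    case m = 2, where S meets all hyperplanes although it has fewer than
    2 (q - 1) elements in excess of the number q^2 - 1 of nontrivial cosets of
    W, and one must find a plane whose nonzero vectors all lie in S.

    If two elements of S are in the same coset, deleting one of them and its
    multiples removes q - 1 elements and leaves a cone that meets the same
    cosets; the bound on |S| allows this only once ([almost_transversal]). So
    up to scalars at most one coset contains two elements x and e of S. One may
    choose a and b in S that span a complement of W and such that x and e lie
    in the coset of a - b. Then, up to scalars, S consists of a, b, x, e and, in characteristic 3, of a single
    element c of the coset of a + b ([frame_exists], [frame_sum_coset]). The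
    value of a functional at a and b, and on W, can be chosen freely. Such
    choices give a functional that vanishes nowhere on S, contradicting the
    maximality of W, unless one of x and e is equal to a - b
    ([frame_hits_difference]) and a + b is in S ([frame_hits_sum]); and then
    the plane spanned by a and b is the required one. *)

(** * Linear functionals and dimensions *)

Section Functionals.
Variables (F : fieldType) (vT : vectType F).
Implicit Types (U W : {vspace vT}) (x y : vT).

Lemma memv_addlineP W x y :
  reflect (exists k, y - k *: x \in W) (y \in W + <[x]>)%VS.
Proof.
apply: (iffP memv_addP) => [[w wW [_ /vlineP[k ->] ->]] | [k ykx]].
  by exists k; rewrite addrK.
exists (y - k *: x) => //; exists (k *: x); last by rewrite subrK.
by rewrite memvZ ?memv_line.
Qed.

Lemma daddv_pi_ker U W x :
  (U :&: W = 0)%VS -> x \in W -> daddv_pi U W x = 0.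
Proof.
move=> UW0 xW; apply: (addIr (daddv_pi W U x)).
rewrite add0r daddv_pi_add //; last by rewrite (subvP (addvSr _ _)).
by rewrite daddv_pi_id // capvC.
Qed.

Lemma daddv_pi_sub U W x :
  (U :&: W = 0)%VS -> (U + W)%VS = fullv -> x - daddv_pi U W x \in W.
Proof.
move=> UW0 UWf; rewrite -{1}[x](daddv_pi_add UW0 (w := x)) ?UWf ?memvf //.
by rewrite addrC addKr memv_pi.
Qed.

Lemma separating_functional U y :
  y \notin U -> exists2 f : 'Hom(vT, F^o), (U <= lker f)%VS & f y = 1.
Proof.
move=> yU; pose z := daddv_pi U^C U y.
have UC0 : (U^C :&: U = 0)%VS by rewrite capvC capv_compl.
have zN0 : z != 0.
  apply: contraNneq yU => z0; rewrite -[y]subr0 -z0 daddv_pi_sub //.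
  by rewrite addvC addv_complf.
have [i ziN0] : exists i, coord (vbasis fullv) i z != 0.
  apply/existsP; apply: contraR zN0; rewrite negb_exists => /forallP zi0.
  rewrite (coord_vbasis (memvf z)) big1 // => i _.
  by rewrite (eqP (negbNE (zi0 i))) scale0r.
pose c : vT -> F^o := coord (vbasis fullv) i.
have c_lin : linear c by move=> k u v; rewrite /c linearP.
pose cL := GRing.isLinear.Build _ _ _ _ c c_lin.
pose cl : {linear vT -> F^o} := HB.pack c cL.
exists ((c z)^-1 *: (linfun cl \o daddv_pi U^C U))%VF.
  apply/subvP => u uU; rewrite memv_ker scale_lfunE comp_lfunE.
  by rewrite daddv_pi_ker // linear0 scaler0.
rewrite scale_lfunE comp_lfunE lfunE /=; exact: mulVf.
Qed.

(** The functionals that vanish on U and at y, and those that vanish on U and at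
    z, form two proper subspaces of the functionals that vanish on U, and over
    any field two proper subspaces do not cover: if f vanishes only at z and g
    only at y, then f + g vanishes at neither. *)
Lemma separating_functional2 U y z :
    y \notin U -> z \notin U ->
  exists f : 'Hom(vT, F^o), [/\ (U <= lker f)%VS, f y != 0 & f z != 0].
Proof.
move=> /separating_functional[f Uf fy] /separating_functional[g Ug gz].
have [fz0 | ?] := eqVneq (f z) 0; last by exists f; rewrite fy oner_eq0.
have [gy0 | ?] := eqVneq (g y) 0; last by exists g; rewrite gz oner_eq0.
exists (f + g); rewrite !add_lfunE fy gz fz0 gy0 addr0 add0r oner_eq0; split=> //.
apply/subvP=> u uU; move: (subvP Uf u uU) (subvP Ug u uU).
by rewrite !memv_ker add_lfunE => /eqP-> /eqP->; rewrite addr0.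
Qed.

Lemma dim_lker_functional (f : 'Hom(vT, F^o)) : (\dim {:vT} <= (\dim (lker f)).+1)%N.
Proof.
rewrite -(limg_ker_dim f fullv) capfv -addn1 leq_add2l.
by rewrite (leq_trans (dimvS (subvf _))) // dimvf.
Qed.

Lemma notin_proper U : (\dim U < \dim {:vT})%N -> exists y, y \notin U.
Proof.
rewrite ltnNge => dU; suff /subvPn[y _ yU] : ~~ (fullv <= U)%VS by exists y.
by apply: contra dU => /dimvS.
Qed.

Lemma dim_add_line U y : (\dim (U + <[y]>) <= (\dim U).+1)%N.
Proof.
by rewrite (leq_trans (dimv_add_leqif U <[y]>)) // dim_vline -addn1 leq_add2l leq_b1.
Qed.

Lemma dim_add_line_proper U y :
  y \notin U -> (\dim U < \dim (U + <[y]>))%N.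
Proof.
move=> yU; rewrite (ltn_leqif (dimv_leqif_sup (addvSl U <[y]>))).
by rewrite subv_add subvv -memvE.
Qed.

End Functionals.

(** * Cones and cosets over a finite field *)

(** Another scalar k would make 0, 1, k and 1 + k distinct. *)
Lemma small_field_unit (F : finFieldType) (k : F) :
  (#|F| <= 3)%N -> k != 0 -> k = 1 \/ k = -1.
Proof.
move=> smallF kN0; have [| k1] := eqVneq k 1; first by left.
have [| kN1] := eqVneq k (-1); first by right.
have uk : uniq [:: 0; 1; k; 1 + k].
  have ne0 : 1 + k != 0 by rewrite addrC addr_eq0.
  have ne1 : 1 != 1 + k by rewrite -subr_eq0 opprD addrA subrr add0r oppr_eq0.
  have nek : k != 1 + k.
    by rewrite addrC -subr_eq0 opprD addrA subrr add0r oppr_eq0 oner_eq0.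
  rewrite /= !inE !negb_or !(eq_sym 0) oner_eq0 kN0 ne0 ne1 nek.
  by rewrite eq_sym k1.
by have := leq_trans (max_card (mem [:: 0; 1; k; 1 + k])) smallF; rewrite (card_uniqP uk).
Qed.

(** Linear identities between row vectors hold entry by entry, where they are
    identities in the field. *)
Ltac row_ring := by let i := fresh in apply/rowP => i; rewrite !mxE; ring.

Section Cosets.
Variables (F : finFieldType) (d : nat).
Notation vT := 'rV[F]_d.
Implicit Types (S R : {set vT}) (V W : {vspace vT}).

Definition cone S := forall l s, l != 0 -> s \in S -> l *: s \in S.
Definition misses W S := forall s, s \in S -> s \notin W.
Definition meets_cosets W S := forall y, y \notin W -> exists2 s, s \in S & s - y \in W.

(** Subspaces are obtained as spans of subsets, which makes them range over a
    finite type. *)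
Lemma maximal_missing_subspace S : 0 \notin S ->
  exists2 W, misses W S & forall W', misses W' S -> (\dim W' <= \dim W)%N.
Proof.
move=> S0; pose P (T : {set vT}) := [forall s in S, s \notin <<enum T>>%VS].
have P0 : P set0.
  apply/forall_inP => s sS; rewrite enum_set0 span_nil memv0.
  by apply: contraNneq S0 => <-.
case: (arg_maxnP (fun T : {set vT} => \dim <<enum T>>%VS) P0) => T /forall_inP PT maxT.
exists <<enum T>>%VS => // W' mW'.
have span_elements : <<enum [set x in W']>>%VS = W'.
  apply/eqP; rewrite eqEsubv; apply/andP; split.
    by apply/span_subvP => x; rewrite mem_enum inE.
  by apply/subvP => x xW'; rewrite memv_span // mem_enum inE.
rewrite -[W']span_elements; apply: maxT.
by apply/forall_inP => s sS; rewrite span_elements mW'.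
Qed.

(** Otherwise S would miss the larger subspace spanned by W and y: an element of
    S in it has a multiple in the coset of y. *)
Lemma maximal_missing_meets_cosets S W : cone S ->
    misses W S -> (forall W', misses W' S -> (\dim W' <= \dim W)%N) ->
  meets_cosets W S.
Proof.
move=> coneS WS maxW y yW.
have [/forall_inP mS | ] := boolP [forall s in S, s \notin (W + <[y]>)%VS].
  have /maxW : misses (W + <[y]>) S by exact: mS.
  rewrite (geq_leqif (dimv_leqif_eq (addvSl W <[y]>))) eqEsubv addvSl /= subv_add.
  by rewrite subvv -memvE (negbTE yW).
case/forall_inPn => s sS /negbNE/memv_addlineP[k skyW].
have kN0 : k != 0.
  by apply: contraNneq (WS s sS) => k0; rewrite k0 scale0r subr0 in skyW.
exists (k^-1 *: s); first by rewrite coneS ?invr_eq0.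
by rewrite -[y](scalerK kN0) -scalerBr memvZ.
Qed.

(** Projecting along W, the set R covers all nonzero vectors of a complement
    of W; the successor accounts for 0. *)
Lemma card_meets_cosets W R : meets_cosets W R ->
  (#|F| ^ (\dim {:vT} - \dim W) <= #|R|.+1)%N.
Proof.
move=> covR; rewrite -dimv_compl -(card_vspace W^C).
have CW0 : (W^C :&: W = 0)%VS by rewrite capvC capv_compl.
have : W^C%VS \subset 0 |: [set daddv_pi W^C W r | r in R].
  apply/subsetP => y yC; rewrite !inE; have [//|yN0 /=] := eqVneq y 0.
  have [|r rR ryW] := covR y.
    by apply: contra yN0 => yW; rewrite -memv0 -CW0 memv_cap yC.
  apply/imsetP; exists r => //; move/(daddv_pi_ker CW0)/eqP: ryW.
  by rewrite linearB /= (daddv_pi_id CW0 yC) subr_eq0 => /eqP.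
move/subset_leq_card/leq_trans; apply; rewrite cardsU1.
apply: (leq_trans (leq_add (leq_b1 _) (leq_imset_card _ _))); by rewrite add1n.
Qed.

(** The multiples of t are redundant, since the multiples of s lie in the same
    cosets; and R contains all q - 1 nonzero multiples of t. *)
Lemma meets_cosets_remove_line W R s t : cone R -> meets_cosets W R ->
    misses W R -> s \in R -> t \in R -> s != t -> s - t \in W ->
  let R' := [set r in R | r \notin <[t]>%VS] in
  [/\ cone R', meets_cosets W R' & (#|R'| + #|F|.-1 <= #|R|)%N].
Proof.
move=> coneR covR WR sR tR st stW R'.
have tW := WR t tR.
have tN0 : t != 0 by apply: contraNneq tW => ->; rewrite mem0v.
have lineZ l r : l != 0 -> (l *: r \in <[t]>%VS) = (r \in <[t]>%VS).
  by move=> lN0; rewrite rpredZeq (negbTE lN0).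
have sl : s \notin <[t]>%VS.
  apply/negP => /vlineP[k sk]; move: stW; rewrite sk -{2}[t]scale1r -scalerBl.
  have [k1|k1] := eqVneq (k - 1) 0.
    by move: st; rewrite sk (subr0_eq k1) scale1r eqxx.
  by rewrite rpredZeq (negbTE k1) (negbTE tW).
split.
- by move=> l r lN0; rewrite !inE lineZ // => /andP[rR ->]; rewrite coneR.
- move=> y yW; have [r rR ryW] := covR y yW.
  have [/vlineP[k rk] | rl] := boolP (r \in <[t]>%VS);
    last by exists r; rewrite // inE rR.
  have kN0 : k != 0 by apply: contraNneq (WR r rR) => k0; rewrite rk k0 scale0r mem0v.
  exists (k *: s); first by rewrite inE lineZ // sl coneR.
  have -> : k *: s - y = k *: (s - t) + (r - y) by rewrite rk scalerBr addrA subrK.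
  by rewrite memvD // memvZ.
- have -> : #|F|.-1 = #|[set k *: t | k in [set~ (0 : F)]]|.
    rewrite card_imset ?cardsC1 // => k l /eqP.
    by rewrite -subr_eq0 -scalerBl scaler_eq0 (negbTE tN0) orbF subr_eq0 => /eqP.
  rewrite -cardsUI [X in (_ + X)%N](_ : _ = 0%N) ?addn0.
    apply/subset_leq_card/subsetP => r; rewrite !inE => /orP[/andP[] //|].
    by case/imsetP => k; rewrite !inE => kN0 ->; rewrite coneR.
  apply/eqP; rewrite cards_eq0; apply/eqP/setP => r; rewrite !inE.
  apply/negP => /andP[/andP[_ rl] /imsetP[k _ rk]].
  by rewrite rk memvZ ?memv_line in rl.
Qed.

End Cosets.

(** * The critical case of codimension two *)

Section Codimension2.
Variables (F : finFieldType) (d : nat).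
Notation vT := 'rV[F]_d.
Variables (S : {set vT}) (W : {vspace vT}).
Hypotheses (coneS : cone S) (WS : misses W S) (covS : meets_cosets W S).
Hypothesis codimW : \dim {:vT} = (\dim W).+2.

(** Up to scalars, S has at most one element too many in the cosets of W: after
    two removals of a line, S would have fewer than q^2 - 1 elements left, and
    could not meet all nontrivial cosets. Here e = x when no coset contains two
    elements of S. *)
Lemma almost_transversal : (#|S| + 3 < #|F| ^ 2 + #|F|.*2)%N ->
  exists x e, [/\ x \in S, e \in S, e - x \in W,
    {in S, forall s, s - x \in W -> s = x \/ s = e} &
    {in S &, forall s t, s \notin (W + <[x]>)%VS -> s - t \in W -> s = t}].
Proof.
move=> small.
have [dbl | ] := boolP [exists s in S, exists t in S, (s != t) && (s - t \in W)].
  case/exists_inP: dbl => s sS /exists_inP[t tS /andP[st stW]].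
  have [coneR covR cardR] := meets_cosets_remove_line coneS covS WS sS tS st stW.
  set R := [set r in S | _] in coneR covR cardR.
  have injR : {in R &, forall u v, u - v \in W -> u = v}.
    move=> u v uR vR uvW; apply/eqP; apply: contraLR small => uv.
    have WR : misses W R by move=> r; rewrite inE => /andP[/WS].
    have [_ covR' cardR'] := meets_cosets_remove_line coneR covR WR uR vR uv uvW.
    have := card_meets_cosets covR'.
    have -> : (\dim {:vT} - \dim W = 2)%N by rewrite codimW -addn2 addKn.
    (* Two removals would leave at least q^2 - 1 elements. *)
    have := finNzRing_gt1 F; rewrite -leqNgt.
    lia.
  have sR : s \in R.
    rewrite inE sS; apply: contra (WS tS) => /vlineP[k sk].
    move: st stW; rewrite -subr_eq0 sk -{2 4}[t]scale1r -scalerBl scaler_eq0 negb_or.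
    by case/andP=> k1 _; rewrite rpredZeq (negbTE k1).
  have offline r : r \in S -> r \notin <[t]>%VS -> r \in R by rewrite inE => ->.
  exists t, s; split=> // [r rS rtW | u v uS vS uW uvW].
    have [/vlineP[k rk] | /(offline r rS) rR] := boolP (r \in <[t]>%VS); [left | right].
      move: rtW; rewrite rk -{2}[t]scale1r -scalerBl rpredZeq (negbTE (WS tS)) orbF.
      by rewrite subr_eq0 => /eqP->; rewrite scale1r.
    apply: injR => //; have -> : r - s = r - t - (s - t) by row_ring.
    by rewrite rpredB.
  apply: injR => //; apply: offline => //.
    by apply: contra uW; apply/subvP/addvSr.
  apply: contra uW => vt; rewrite -(subrK v u) memv_add //.
rewrite negb_exists_in => /forall_inP inj.
have {}inj : {in S &, forall s t, s - t \in W -> s = t}.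
  move=> s t sS tS stW; move: (inj s sS); rewrite negb_exists_in => /forall_inP/(_ t tS).
  by rewrite stW andbT negbK => /eqP.
have [|y yW] := @notin_proper _ _ W; first by rewrite codimW ltnS leqnSn.
have [x xS _] := covS yW; exists x, x; split=> //; first by rewrite subrr mem0v.
  by move=> s sS /inj-> //; left.
by move=> s t sS tS _ /inj->.
Qed.

(** Coordinates modulo W in which S is explicit. The classes of a and b form a
    basis of the quotient by W, and the fibres of S over this quotient are
    known: the one over a - b is {x, e}, and those over k a + l b with
    k + l != 0, that is, over the points that are not proportional to a - b,
    have at most one element. *)
Definition frame x e a b :=
  [/\ [/\ x \in S, e \in S, a \in S & b \in S],
      [/\ x - (a - b) \in W, e - (a - b) \in W &
        {in S, forall s, s - (a - b) \in W -> s = x \/ s = e}],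
      forall k l, k *: a + l *: b \in W -> k = 0 /\ l = 0,
      forall y, exists k l, y - (k *: a + l *: b) \in W &
      {in S &, forall s t, s - t \in W -> forall k l, s - (k *: a + l *: b) \in W ->
          k + l != 0 -> s = t}].

(** Take a in S outside of the span of W and x, then b in S in the coset
    of a - x. *)
Lemma frame_exists : (#|S| + 3 < #|F| ^ 2 + #|F|.*2)%N ->
  exists x e a b, frame x e a b.
Proof.
case/almost_transversal => x [e [xS eS exW Hx Hinj]].
have [|y yWx] := @notin_proper _ _ (W + <[x]>).
  by rewrite codimW ltnS dim_add_line.
have [|a aS ayW] := covS (y := y); first by apply: contra yWx; apply/subvP/addvSl.
have aWx : a \notin (W + <[x]>)%VS.
  by apply: contra yWx => aWx; rewrite -(subKr a y) memvB // (subvP (addvSl _ _)).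
have [|b bS baxW] := covS (y := a - x).
  by apply: contra aWx => axW; apply/memv_addlineP; exists 1; rewrite scale1r.
have xabW : x - (a - b) \in W.
  by have -> : x - (a - b) = b - (a - x) by row_ring.
have full y' : exists k l, y' - (k *: a + l *: b) \in W.
  have : y' \in (W + <[x]> + <[a]>)%VS.
    suff /eqP-> : (W + <[x]> + <[a]> == fullv)%VS by apply: memvf.
    rewrite eqEdim subvf codimW (leq_trans _ (dim_add_line_proper aWx)) //.
    by rewrite ltnS; apply/dim_add_line_proper/WS.
  case/memv_addlineP => k /memv_addlineP[l].
  rewrite -[x](subrK (a - b)) => yW; exists (k + l), (- l).
  have := memvD yW (memvZ l xabW); congr (_ \in W).
  by row_ring.
have a_coord k m : k *: a - m *: x \in W -> k = 0.
  move=> kmW; apply: contraNeq aWx => kN0; apply/memv_addlineP; exists (k^-1 * m).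
  by rewrite -scalerA -{1}[a](scalerK kN0) -scalerBr memvZ.
exists x, e, a, b; split=> //.
- split=> //.
    have -> : e - (a - b) = e - x + (x - (a - b)) by row_ring.
    by rewrite rpredD.
  move=> s sS sabW; apply: Hx => //.
  have -> : s - x = s - (a - b) - (x - (a - b)) by row_ring.
  by rewrite rpredB.
- move=> k l klW.
  have kl0 : k + l = 0.
    apply: (a_coord _ l); have := memvD klW (memvZ (- l) baxW); congr (_ \in W).
    by row_ring.
  suff l0 : l = 0 by rewrite l0 addr0 in kl0.
  have : l *: x \in W.
    have := rpredB (rpredZ l baxW) klW; congr (_ \in W).
    have -> : k = - l by apply/eqP; rewrite -addr_eq0 kl0.
    by row_ring.
  by rewrite rpredZeq (negbTE (WS xS)) orbF => /eqP.
- move=> s t sS tS stW k l sklW klN0; apply: Hinj => //.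
  apply: contra klN0 => /memv_addlineP[m smW]; apply/eqP/(a_coord _ (l + m)).
  have := rpredD (rpredB smW sklW) (rpredZ (- l) baxW); congr (_ \in W).
  by row_ring.
Qed.

(** Since a, b and W are in direct sum, a functional may be prescribed
    separately on each of them; on W it is prescribed by h. *)
Lemma frame_functional x e a b i j (h : 'Hom(vT, F^o)) :
    frame x e a b -> (<[a]> + <[b]> <= lker h)%VS ->
  exists f : 'Hom(vT, F^o), [/\ f a = i, f b = j &
    forall c y, y - c \in W -> f y = f c + h (y - c)].
Proof.
case=> _ _ indep _ _ abh.
have [|f /subvP Wbf fa] := @separating_functional _ _ (W + <[b]>)%VS a.
  apply/negP => /memv_addlineP[l labW].
  have [] := indep 1 (- l); first by rewrite scale1r scaleNr.
  by move/eqP; rewrite oner_eq0.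
have [|g /subvP Wag gb] := @separating_functional _ _ (W + <[a]>)%VS b.
  apply/negP => /memv_addlineP[l labW].
  have [] := indep (- l) 1; first by rewrite scale1r scaleNr addrC.
  by move=> _ /eqP; rewrite oner_eq0.
have zero (u : 'Hom(vT, F^o)) y : y \in lker u -> u y = 0 by rewrite memv_ker => /eqP.
have W_ker c y : y \in W -> y \in (W + <[c]>)%VS by apply/subvP/addvSl.
have c_ker c : c \in (W + <[c]>)%VS by apply/(subvP (addvSr _ _))/memv_line.
exists (i *: f + j *: g + h); split=> [||c y ycW].
- rewrite !add_lfunE !scale_lfunE fa (zero g) ?Wag //
    (zero h) ?(subvP abh) ?(subvP (addvSl _ _)) ?memv_line //.
  by rewrite scaler0 !addr0; apply: mulr1.
- rewrite !add_lfunE !scale_lfunE gb (zero f) ?Wbf //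
    (zero h) ?(subvP abh) ?(subvP (addvSr _ _)) ?memv_line //.
  by rewrite scaler0 add0r addr0; apply: mulr1.
- rewrite -{1}(subrK c y) linearD /= addrC; congr (_ + _); rewrite !add_lfunE !scale_lfunE.
  by rewrite (zero f) ?Wbf ?W_ker // (zero g) ?Wag ?W_ker // !scaler0 !add0r.
Qed.

Hypothesis smallF : (#|F| <= 3)%N.

(** Only the scalars 1 and -1 are nonzero, so that every vector outside of W is,
    modulo W, proportional to one of a, b, a - b and a + b. In
    characteristic 2 the last two coincide. *)
Lemma frame_nonvanishing x e a b (f : 'Hom(vT, F^o)) : frame x e a b ->
    f a != 0 -> f b != 0 -> f x != 0 -> f e != 0 ->
    {in S, forall t, t - (a + b) \in W -> f t != 0} ->
  {in S, forall s, f s != 0}.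
Proof.
case=> [[xS eS aS bS] [xW eW Hxe] _ full inj] fa fb fx fe ft s sS.
have [k [l sW]] := full s.
have [kl0 | klN0] := eqVneq (k + l) 0.
  have lE : l = - k by apply/eqP; rewrite -addr_eq0 addrC kl0.
  have kN0 : k != 0.
    apply: contraNneq (WS sS) => k0; move: sW.
    by rewrite lE k0 oppr0 !scale0r addr0 subr0.
  have ksW : k^-1 *: s - (a - b) \in W.
    by rewrite -[a - b](scalerK kN0) -scalerBr rpredZ // scalerBr -scaleNr -lE.
  suff : f (k^-1 *: s) != 0 by rewrite linearZ scaler_eq0 negb_or => /andP[].
  by case: (Hxe _ _ ksW) => [| -> | ->] //; rewrite coneS ?invr_eq0.
have [k0 | kN0] := eqVneq k 0.
  rewrite k0 add0r in klN0.
  rewrite (inj s (l *: b) sS _ _ k l) ?coneS ?k0 ?add0r //.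
  - by rewrite linearZ scaler_eq0 negb_or klN0.
  - by move: sW; rewrite k0 scale0r add0r.
  - by move: sW; rewrite k0 scale0r add0r.
have [l0 | lN0] := eqVneq l 0.
  rewrite l0 addr0 in klN0.
  rewrite (inj s (k *: a) sS _ _ k l) ?coneS ?l0 ?addr0 //.
  - by rewrite linearZ scaler_eq0 negb_or klN0.
  - by move: sW; rewrite l0 scale0r addr0.
  - by move: sW; rewrite l0 scale0r addr0.
have lkE : l = k.
  have [|/(canRL (mulfVK kN0))|/(canRL (mulfVK kN0))] :=
    @small_field_unit _ (l / k) smallF.
  - by rewrite mulf_neq0 ?invr_eq0.
  - by rewrite mul1r.
  - by move=> lE; move: klN0; rewrite lE mulN1r subrr eqxx.
have ksW : k^-1 *: s - (a + b) \in W.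
  by rewrite -[a + b](scalerK kN0) -scalerBr rpredZ // scalerDr -{2}lkE.
suff : f (k^-1 *: s) != 0 by rewrite linearZ scaler_eq0 negb_or => /andP[].
by apply: ft ksW; rewrite coneS ?invr_eq0.
Qed.

Lemma frame_plane x e a b : frame x e a b -> a + b \in S -> a - b \in S ->
  exists2 V, (V + W)%VS = fullv & {in V, forall v, v != 0 -> v \in S}.
Proof.
case=> [[_ _ aS bS] _ _ full _] abS aNbS; exists (<[a]> + <[b]>)%VS.
  apply/eqP; rewrite eqEsubv subvf /=; apply/subvP => y _.
  have [k [l yW]] := full y; rewrite -(subrK (k *: a + l *: b) y) addrC.
  by rewrite !memv_add ?memvZ ?memv_line.
move=> _ /memv_addP[_ /vlineP[k ->] [_ /vlineP[l ->] ->]].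
have [-> | kN0] := eqVneq k 0.
  have [-> | lN0] := eqVneq l 0; first by rewrite !scale0r addr0 eqxx.
  by rewrite scale0r add0r coneS.
have [-> | lN0] := eqVneq l 0; first by rewrite scale0r addr0 coneS.
move=> _; have [|/(canRL (mulfVK kN0))|/(canRL (mulfVK kN0))] :=
    @small_field_unit _ (l / k) smallF.
- by rewrite mulf_neq0 ?invr_eq0.
- by rewrite mul1r => ->; rewrite -scalerDr coneS.
- by rewrite mulN1r => ->; rewrite scaleNr -scalerBr coneS.
Qed.

Lemma frame_sym x e a b : frame x e a b -> frame e x a b.
Proof.
case=> [[? ? ? ?] [? ? Hxe] ? ? ?]; do 2!split=> //.
by move=> s sS /(Hxe s sS)[]; [right | left].
Qed.


Lemma frame_plane_disjoint x e a b w :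
  frame x e a b -> w \in W -> w != 0 -> w \notin (<[a]> + <[b]>)%VS.
Proof.
case=> _ _ indep _ _ wW wN0; apply/negP => /memv_addP[_ /vlineP[k ->] [_ /vlineP[l ->] wE]].
case: (indep k l); first by rewrite -wE.
by move=> k0 l0; move: wN0; rewrite wE k0 l0 !scale0r addr0 eqxx.
Qed.

(** In odd characteristic the fibre over a + b falls among those with a single
    element, because 1 + 1 is not zero. *)
Lemma frame_sum_coset x e a b : frame x e a b -> 2%:R != 0 :> F ->
  exists c, [/\ c \in S, c - (a + b) \in W &
    {in S, forall t, t - (a + b) \in W -> t = c}].
Proof.
case=> _ _ indep _ inj two; have [|c cS cW] := covS (y := a + b).
  apply/negP => abW; have [] := indep 1 1; first by rewrite !scale1r.
  by move/eqP; rewrite oner_eq0.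
exists c; split=> // t tS tW; apply: (inj t c tS cS _ 1 1); rewrite ?scale1r //.
have -> : t - c = t - (a + b) - (c - (a + b)) by row_ring.
by rewrite rpredB.
Qed.

(** One of the two signs always works, as 2 + u and 2 - u add up to 4. *)
Lemma sign_choice (u : F) : 2%:R != 0 :> F -> exists2 k : F, k != 0 & 2%:R + k * u != 0.
Proof.
move=> two; have [u0 | uN0] := eqVneq (2%:R + u) 0;
  last by exists 1; rewrite ?oner_eq0 ?mul1r.
exists (-1); first by rewrite oppr_eq0 oner_eq0.
have -> : 2%:R + -1 * u = 2%:R * 2%:R - (2%:R + u) by ring.
by rewrite u0 subr0 mulf_neq0.
Qed.

Hypothesis no_functional : forall f : 'Hom(vT, F^o), ~ {in S, forall s, f s != 0}.

(** Otherwise a functional with value 1 at a and b, equal on W to a multiple of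
    some h that vanishes neither at x - (a - b) nor at e - (a - b), is nonzero
    on S: it takes the values of this multiple at these two vectors on x and e,
    and on the element c over a + b it takes the value 2 plus that of the
    multiple at c - (a + b), which a suitable sign makes nonzero. *)
Lemma frame_hits_difference x e a b : frame x e a b -> x = a - b \/ e = a - b.
Proof.
move=> fr; have [->|xab] := eqVneq x (a - b); first by left.
have [->|eab] := eqVneq e (a - b); first by right.
exfalso; have [_ [xW eW Hxe] _ _ _] := fr.
have [||h [abh hx he]]
    := @separating_functional2 _ _ (<[a]> + <[b]>)%VS (x - (a - b)) (e - (a - b)).
- by apply: frame_plane_disjoint fr _ _; rewrite ?subr_eq0.
- by apply: frame_plane_disjoint fr _ _; rewrite ?subr_eq0.
have [k kN0 kab] : exists2 k : F, k != 0 &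
    {in S, forall t, t - (a + b) \in W -> 2%:R + k * h (t - (a + b)) != 0}.
  have [two0 | two] := eqVneq (2%:R : F) 0.
    (* In characteristic 2 the fibre over a + b is again {x, e}. *)
    exists 1; first exact: oner_neq0.
    have <- : a - b = a + b.
      have -> : a - b = a + b - 2%:R *: b by row_ring.
      by rewrite two0 scale0r subr0.
    by move=> t tS tW; rewrite two0 add0r mul1r; case: (Hxe t tS tW) => ->.
  have [c [cS cW Hc]] := frame_sum_coset fr two.
  have [k kN0 kc] := sign_choice (h (c - (a + b))) two.
  by exists k => // t tS /(Hc t tS) ->.
have [|f [fa fb fW]] := @frame_functional x e a b 1 1 (k *: h) fr.
  apply: subv_trans abh _; apply/subvP => y.
  by rewrite !memv_ker scale_lfunE => /eqP->; rewrite scaler0.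
have fab y : y - (a - b) \in W -> f y = k *: h (y - (a - b)).
  by move=> yW; rewrite (fW _ _ yW) scale_lfunE [f _]linearB /= fa fb subrr add0r.
apply: (@no_functional f); apply: (frame_nonvanishing fr).
- by rewrite fa oner_neq0.
- by rewrite fb oner_neq0.
- by rewrite fab // scaler_eq0 negb_or kN0.
- by rewrite fab // scaler_eq0 negb_or kN0.
by move=> t tS tW; rewrite (fW _ _ tW) scale_lfunE [f _]linearD /= fa fb; apply: kab.
Qed.

(** In characteristic 2, a + b and a - b are equal. Otherwise let c be the
    element of S over a + b; if it is not a + b, a functional with values 1 at
    a and -1 at b, and equal on W to a multiple of some h that is nonzero at
    c - (a + b), is nonzero on S: its value is 2 at x, nonzero at c, and 2 plus
    that of the multiple at e - (a - b), up to the choice of a sign, at e. *)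
Lemma frame_hits_sum x e a b : frame x e a b -> x = a - b -> a + b \in S.
Proof.
move=> fr xab; have [[xS _ _ _] [_ eW _] _ _ _] := fr.
have [two0 | two] := eqVneq (2%:R : F) 0.
  have -> : a + b = a - b + 2%:R *: b by row_ring.
  by rewrite two0 scale0r addr0 -xab.
have [c [cS cW Hc]] := frame_sum_coset fr two.
have [<- // | cab] := eqVneq c (a + b); exfalso.
have [|h abh hc] := @separating_functional _ _ (<[a]> + <[b]>)%VS (c - (a + b)).
  by apply: frame_plane_disjoint fr _ _; rewrite ?subr_eq0.
have [k kN0 ke] := sign_choice (h (e - (a - b))) two.
have [|f [fa fb fW]] := @frame_functional x e a b 1 (-1) (k *: h) fr.
  apply: subv_trans abh _; apply/subvP => y.
  by rewrite !memv_ker scale_lfunE => /eqP->; rewrite scaler0.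
apply: (@no_functional f); apply: (frame_nonvanishing fr).
- by rewrite fa oner_neq0.
- by rewrite fb oppr_eq0 oner_neq0.
- by rewrite xab linearB /= fa fb opprK.
- by rewrite (fW _ _ eW) scale_lfunE [f _]linearB /= fa fb opprK.
move=> t tS /(Hc t tS) ->; rewrite (fW _ _ cW) scale_lfunE.
by rewrite [f _]linearD /= fa fb subrr add0r hc scaler_eq0 negb_or kN0 oner_neq0.
Qed.

Lemma codimension2_complement : (#|S| + 3 < #|F| ^ 2 + #|F|.*2)%N ->
  exists2 V, (V + W)%VS = fullv & {in V, forall v, v != 0 -> v \in S}.
Proof.
case/frame_exists => x [e [a [b fr]]].
have [y [e' [fr' yab]]] : exists y e', frame y e' a b /\ y = a - b.
  case: (frame_hits_difference fr); first by exists x, e.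
  by exists e, x; split=> //; apply: frame_sym.
apply: (frame_plane fr'); first exact: frame_hits_sum fr' yab.
by rewrite -yab; case: fr' => [[]].
Qed.
End Codimension2.

(** * Splitting the space along a small symmetric set *)

Section Splitting.
Variables (F : finFieldType) (d : nat).
Notation vT := 'rV[F]_d.

(** The linear certificate that V is a complete core of the Cayley graph of S:
    V is a clique, and the cosets of W are independent sets, as many as V has
    elements. *)
Definition splits (S : {set vT}) (V W : {vspace vT}) :=
  [/\ (V + W)%VS = fullv, {in V, forall v, v != 0 -> v \in S} & misses W S].

Lemma cone_splits (S : {set vT}) : (#|F| <= 3)%N -> cone S -> 0 \notin S ->
  (#|S| + 3 < #|F| ^ 2 + #|F|.*2)%N -> exists V W, splits S V W.
Proof.
move=> smallF coneS S0 smallS.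
have [W WS maxW] := maximal_missing_subspace S0.
have covS := maximal_missing_meets_cosets coneS WS maxW.
have dimE := subnKC (dimvS (subvf W)).
have := card_meets_cosets covS.
case codimE: (\dim {:vT} - \dim W)%N => [|[|[|m]]] cardS;
  rewrite codimE in dimE.
- exists 0%VS, W; split=> //; last by move=> v; rewrite memv0 => ->.
  by rewrite add0v; apply/eqP; rewrite eqEdim subvf -dimE addn0 leqnn.
- have [|y yW] := @notin_proper _ _ W; first by rewrite -dimE addn1.
  have [s sS _] := covS y yW; exists <[s]>%VS, W; split=> //.
    apply/eqP; rewrite addvC eqEdim subvf.
    by apply: leq_trans (dim_add_line_proper (WS s sS)); rewrite -dimE addn1.
  by move=> _ /vlineP[k ->]; rewrite scaler_eq0 negb_or => /andP[kN0 _]; rewrite coneS.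
- have [||V VW VS] := codimension2_complement coneS WS covS _ smallF _ smallS.
  + by rewrite -dimE addn2.
  + move=> f fS; have /maxW : misses (lker f) S by move=> s sS; rewrite memv_ker fS.
    by rewrite leqNgt -ltnS (leq_trans _ (dim_lker_functional f)) // -dimE addn2.
  by exists V, W.
(* Codimension at least 3 would require q^3 - 1 <= |S|. *)
- have q1 : (1 < #|F|)%N := finNzRing_gt1 F.
  have : (#|F| ^ 3 <= #|F| ^ m.+3)%N by rewrite leq_exp2l.
  have : (#|F| = 2 \/ #|F| = 3)%N.
    by move: q1 smallF; case: #|F| => [|[|[|[|]]]] //; [left | right].
  by move=> [] qE; move: smallS cardS; rewrite qE; lia.
Qed.

Lemma splits_complement (S : {set vT}) V W :
  0 \notin S -> splits (~: S :\ 0) V W -> splits S W V.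
Proof.
move=> S0 [VW VD WD]; split; first by rewrite addvC.
  by move=> w wW wN0; apply: contraLR wW => wS; apply: WD; rewrite !inE wN0.
move=> s sS; apply: contraL (sS) => sV.
by have := VD s sV; rewrite !inE; case: eqP => [-> | _ /(_ isT)].
Qed.

End Splitting.

(** For p <= 3 the nonzero scalars are 1 and -1, so that S is a cone. For
    p >= 5, S is empty: it has at most one element s, whence s = - s and
    s = 0. *)
Lemma symmetric_splits (p d : nat) (S : {set 'rV['F_p]_d}) : prime p ->
    0 \notin S -> {in S, forall s, - s \in S} -> (#|S| < kappa p)%N ->
  exists V W, splits S V W.
Proof.
move=> p_pr S0 symS; have p_gt1 := prime_gt1 p_pr.
have [small | big] := leqP p 3.
  have cardF : #|'F_p| = p by rewrite card_Fp.
  move=> smallS; apply: cone_splits; rewrite ?cardF //.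
    move=> k s kN0 sS; case: (small_field_unit (k := k)); rewrite ?cardF // => ->.
      by rewrite scale1r.
    by rewrite scaleN1r symS.
  move: #|S| small smallS p_gt1 => n; case: (p) => [|[|[|[|]]]] // _; rewrite /kappa /=; lia.
have -> : kappa p = 2%N by rewrite /kappa; case: eqP big => [->|_] //; case: eqP => [->|].
rewrite ltnS => /card_le1_eqP S1; exists 0%VS, fullv; split; first exact: add0v.
  by move=> v; rewrite memv0 => ->.
move=> s sS; have sN : s = - s by apply: S1 => //; apply: symS.
case/negP: S0; rewrite (_ : 0 = s) //; apply/rowP => i; rewrite mxE.
have two : 2%:R != 0 :> 'F_p.
  by rewrite -(dvdn_pcharf (pchar_Fp p_pr)) gtnNdvd //; lia.
apply/esym/eqP; have /eqP : 2%:R * s 0 i = 0 by rewrite mulr_natl mulr2n {1}sN mxE addNr.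
by rewrite mulf_eq0 (negbTE two).
Qed.

(** * From linear splittings to cores *)

(** An endomorphism of a finite complete graph is injective for lack of loops. *)
Lemma complete_is_core (X : sgraph) : complete X -> is_core X.
Proof.
move=> cX f homf.
have injf : injective f.
  move=> x y fxy; apply/eqP; apply: contraT => /cX/homf.
  by rewrite fxy adj_irr.
exists (invF injf); split; [ | exact: invF_f | exact: f_invF].
move=> x y xy; apply: cX; apply: contraTneq xy => /(can_inj (f_invF injf)) ->.
by rewrite adj_irr.
Qed.

Lemma splits_core (F : finFieldType) d (C : connection_set 'rV[F]_d)
    (V W : {vspace 'rV[F]_d}) : splits C V W ->
  let XV := induced (X := Cay C) [set x : 'rV[F]_d | x \in V] in
  complete XV /\ is_core_of XV.
Proof.
case=> VWf VC WC XV.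
have VW0 : (V :&: W = 0)%VS.
  apply/eqP; rewrite -subv0; apply/subvP => v /memv_capP[vV vW]; rewrite memv0.
  by apply: contraTT vW => vN0; apply: WC; apply: VC.
have cXV : complete XV.
  move=> x y xy; apply: VC; last by rewrite subr_eq0; apply: contra xy => /eqP/val_inj->.
  by rewrite rpredB //; [move: (valP x) | move: (valP y)]; rewrite inE.
split=> //; split; last exact: complete_is_core.
have piV x : daddv_pi V W x \in [set x : 'rV[F]_d | x \in V] by rewrite inE memv_pi.
exists (fun x => Sub (daddv_pi V W x) (piV x) : XV).
  move=> x y xyC; apply: cXV; apply: contraTneq xyC => /(congr1 val) /= xy.
  apply: contraL (_ : x - y \in W); first exact: WC.
  have -> : x - y = x - daddv_pi V W x - (y - daddv_pi V W y).
    by rewrite xy opprB addrA subrK.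
  by rewrite rpredB // daddv_pi_sub.
move=> y; apply: val_inj => /=; apply: daddv_pi_id => //.
by move: (valP y); rewrite inE.
Qed.

Close Scope ring_scope.

Theorem theorem1p3 (p d k : nat) (C : connection_set 'rV['F_p]_d) :
  prime p ->
  regular (Cay C) k ->
  (k < kappa p \/ k >= p ^ d - kappa p) ->
  exists V : {vspace 'rV['F_p]_d},
    let XV := induced (X := Cay C) [set x : 'rV['F_p]_d | x \in V] in
    complete XV /\ is_core_of XV.
Proof.
move=> p_pr regk; rewrite -(regk 0%R) Cay_regular.
case=> [low | high].
  have [|V [W VW]] := symmetric_splits p_pr (conn0 C) _ low.
    by move=> s; rewrite conn_oppr.
  by exists V; apply: splits_core VW.
pose D := ~: C :\ 0%R.
have [|||V [W VW]] := @symmetric_splits p d D p_pr.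
- by rewrite !inE eqxx.
- by move=> s; rewrite !inE oppr_eq0 conn_oppr.
- have := cardsC C; rewrite (cardsD1 0%R (~: C)) inE (conn0 C) card_mx mul1n card_Fp //.
  by move=> cardD; move: high; rewrite leq_subLR -cardD addnC leq_add2r add1n.
by exists W; apply/splits_core/splits_complement/VW/conn0.
Qed.
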